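(* Let $d\ge 2$ be an integer. Let $H$ be a connected graph with maximum degree $d$ and $N$ vertices, where $N>d^{d^{d^d}}$, and let $U_+,U_-\subseteq V(H)$ be disjoint. Then there exists a graph $G$ such that $N\le|V(G)|\le 2^{d^{21d+20}}N$, the maximum degree of $G$ is at most $d\,2^{d^{21d+20}}$, and there are at least $2^{|V(G)|/2^{d^{21d+20}}}$ sets $S\subseteq V(G)$ such that $G[S]$ is a maximal $(U_+,U_-)$-prescribed induced blow-up of $H$.
   Context: All graphs are finite and simple. With $V(H)=\{1,\dots,k\}$, a $(U_+,U_-)$-prescribed induced blow-up of $H$ is a graph whose vertex set is partitioned into nonempty sets $V_1\sqcup\dots\sqcup V_k$ such that for $i\neq j$, $V_i$ is complete to $V_j$ if $ij\in E(H)$ and there are no edges between $V_i$ and $V_j$ if $ij\notin E(H)$; moreover $V_i$ is a clique for $i\in U_+$ and an independent set for $i\in U_-$. For $S\subseteq V(G)$, $G[S]$ is a maximal such blow-up if $G[S]$ is one and there is no $S'$ with $S\subsetneq S'\subseteq V(G)$ such that $G[S']$ is one. *)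

(* Defs.v *)
From mathcomp Require Import all_boot.

Set Implicit Arguments.
Unset Strict Implicit.
Unset Printing Implicit Defensive.

Record sgraph := SGraph {
  vertex :> finType;
  edge : rel vertex;
  edge_sym : symmetric edge;
  edge_irrefl : irreflexive edge
}.

Section Graph.
Variable G : sgraph.
Implicit Types (x y : G) (A B S : {set G}).

Definition degree x : nat := #|[set y | edge x y]|.

Definition max_degree : nat := \max_(x : G) degree x.

Definition connected_graph : bool :=
  (0 < #|G|) && [forall x : G, forall y : G, connect (@edge G) x y].

Definition complete_to A B : bool :=
  [forall x in A, forall y in B, edge x y].

Definition anticomplete_to A B : bool :=
  [forall x in A, forall y in B, ~~ edge x y].

Definition clique A : bool :=
  [forall x in A, forall y in A, (x != y) ==> edge x y].

Definition independent A : bool :=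
  [forall x in A, forall y in A, ~~ edge x y].

Definition induced_edge S : rel {x : G | x \in S} :=
  fun u v => edge (val u) (val v).

Lemma induced_edge_sym S : symmetric (@induced_edge S).
Proof. by move=> u v; apply: edge_sym. Qed.

Lemma induced_edge_irrefl S : irreflexive (@induced_edge S).
Proof. by move=> u; apply: edge_irrefl. Qed.

Definition induced S : sgraph :=
  SGraph (@induced_edge_sym S) (@induced_edge_irrefl S).

End Graph.

Section Blowup.
Variables (H : sgraph) (Up Um : {set H}).

(* The part [V i] induces an arbitrary graph when [i] is in neither [Up] nor [Um]. *)
Definition blowup_partition (G : sgraph) (V : {ffun H -> {set G}}) : bool :=
  [&& [forall i, V i != set0],
      [forall i, forall j, (i != j) ==> [disjoint V i & V j]],
      \bigcup_i V i == [set: G],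
      [forall i, forall j, (i != j) ==>
         (if edge i j then complete_to (V i) (V j)
          else anticomplete_to (V i) (V j))],
      [forall i in Up, clique (V i)]
    & [forall i in Um, independent (V i)]].

Definition prescribed_blowup (G : sgraph) : bool :=
  [exists V : {ffun H -> {set G}}, blowup_partition V].

Definition maximal_blowup (G : sgraph) (S : {set G}) : bool :=
  prescribed_blowup (induced S) &&
  [forall S' : {set G}, (S \proper S') ==> ~~ prescribed_blowup (induced S')].

Definition maximal_blowups (G : sgraph) : {set {set G}} :=
  [set S | maximal_blowup S].

End Blowup.

(* Main.v *)
(**
Call a vertex set [M] a module if every vertex outside [M] is adjacent to all or
to none of [M], and call two vertices inseparable if some proper module contains
both. In [H] every vertex [x] has a neighbour [nu x] from which it is separable:
take any neighbour of [x] outside a maximal proper module containing [x].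

Choose a maximal set [U] of vertices such that distinct edges [a (nu a)], for [a]
in [U], neither meet nor are joined by an edge; bounded degree makes [U] of linear
size. Obtain [G] from [H] by giving each of these edges a second copy, with the
same outside neighbours and no edge between the two copies. Choosing one copy of
each edge gives [2 ^ #|U|] induced copies of [H] in [G].

No blow-up of [H] contains two of these copies of [H], so they extend to distinct
maximal blow-ups. Indeed, if a blow-up [Y] contains a copy of [H], then counting
pairwise separable vertices shows that each vertex of [Y] lies in a module of [Y]
which meets, but does not contain, this copy. If [Y] also contains the second
copy of the edge [a (nu a)], apply this to both its ends: the two resulting
modules [M1] and [M2] avoid [a] and [nu a]. If they meet, then [a] and [nu a] are
twins, hence inseparable; if not, they are completely joined, which makes [a]
adjacent to [M2], a contradiction.
*)

Require Import Defs.
From mathcomp Require Import all_boot all_order all_algebra.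
From mathcomp Require Import reals exp.
Import Order.TTheory GRing.Theory Num.Theory.

Set Implicit Arguments.
Unset Strict Implicit.
Unset Printing Implicit Defensive.

(** * Modules and inseparability in a connected graph *)

Section Modules.
Variable G : sgraph.
Implicit Types (x y z : G) (M : {set G}).

Definition module M : bool :=
  [forall z, forall x in M, forall y in M,
     (z \notin M) ==> (edge z x == edge z y)].

Definition inseparable x y : bool :=
  [exists M : {set G}, [&& module M, M != setT, x \in M & y \in M]].

Lemma moduleP M :
  reflect (forall x y z, x \in M -> y \in M -> z \notin M ->
             edge z x = edge z y)
          (module M).
Proof.
apply: (iffP idP) => [mM x y z xM yM zM | mM].
  move/forallP/(_ z)/forall_inP/(_ x xM)/forall_inP/(_ y yM): mM.
  by rewrite zM => /eqP.
apply/forallP => z; apply/forall_inP => x xM; apply/forall_inP => y yM.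
by apply/implyP => zM; apply/eqP; apply: mM.
Qed.

Lemma moduleU M1 M2 x :
  module M1 -> module M2 -> x \in M1 -> x \in M2 -> module (M1 :|: M2).
Proof.
move=> /moduleP m1 /moduleP m2 x1 x2; apply/moduleP => a b z.
rewrite !inE negb_or => aM bM /andP[z1 z2].
have to_x c : (c \in M1) || (c \in M2) -> edge z c = edge z x.
  by case/orP => cM; [apply: m1 | apply: m2].
by rewrite !to_x.
Qed.

Lemma module1 x : module [set x].
Proof. by apply/moduleP => a b z /set1P -> /set1P ->. Qed.

Lemma inseparable_sym : symmetric inseparable.
Proof.
by move=> x y; apply: eq_existsb => M; rewrite [(x \in M) && _]andbC.
Qed.

Lemma inseparablexx x : (1 < #|G|)%N -> inseparable x x.
Proof.
move=> G1; apply/existsP; exists [set x].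
rewrite module1 set11 !andbT /=; apply: contraTneq G1 => xT.
by rewrite -cardsT -xT cards1.
Qed.

(** If no outside vertex had a neighbour in [M], then [M] would be closed under adjacency, hence
    everything by connectedness. A vertex outside a module with one neighbour in it sees all of
    it. *)
Lemma module_dominated M x :
  connected_graph G -> module M -> M != setT -> x \in M ->
  exists2 z, z \notin M & forall y, y \in M -> edge z y.
Proof.
case/andP=> _ /forallP conn /moduleP mM MT xM.
have [zM | M_all] := boolP [exists z, (z \notin M) && [exists y in M, edge z y]].
  case/existsP: zM => z /andP[zM /exists_inP[y yM zy]].
  by exists z => // t tM; rewrite (mM t y).
case/negP: MT; apply/eqP/setP => y; rewrite inE.
have clM : closed (@edge G) (mem M).
  apply: intro_closed => [|a b ab aM]; first exact/sym_connect_sym/edge_sym.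
  apply: contraR M_all => bM; apply/existsP; exists b; rewrite bM.
  by apply/exists_inP; exists a; rewrite // edge_sym.
by rewrite -(closed_connect clM (forallP (conn x) y)).
Qed.

Lemma card_module_le M x k :
  connected_graph G -> (forall y, degree y <= k)%N ->
  module M -> M != setT -> x \in M -> (#|M| <= k)%N.
Proof.
move=> conn degk mM MT xM.
have [z _ zM] := module_dominated conn mM MT xM.
apply: leq_trans (degk z); apply/subset_leq_card/subsetP => y yM.
by rewrite inE zM.
Qed.

Lemma separated_neighbor d x :
  connected_graph G -> (1 < #|G|)%N -> (forall y, degree y <= d)%N ->
  (2 * d < #|G|)%N ->
  exists z, edge x z && ~~ inseparable x z.
Proof.
move=> conn G1 degd Gd.
have /existsP[M0 /and4P[mM0 M0T xM0 _]] := inseparablexx x G1.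
pose P M := [&& module M, M != setT & x \in M].
have PM0 : P M0 by rewrite /P mM0 M0T.
have [M /maxsetP[/and3P[mM MT xM] maxM] _] := maxset_exists PM0.
have [z zM zdom] := module_dominated conn mM MT xM.
exists z; rewrite edge_sym zdom //=; apply/negP.
case/existsP=> M2 /and4P[mM2 M2T xM2 zM2].
have le1 := card_module_le conn degd mM MT xM.
have le2 := card_module_le conn degd mM2 M2T xM2.
(* Both modules have at most [d] vertices, so their union, a module through [x] and [z], is still
   proper; this contradicts the maximality of [M]. *)
case/negP: zM; rewrite -(maxM (M :|: M2)) ?subsetUl //; first by rewrite inE zM2 orbT.
rewrite /P (moduleU mM mM2 xM xM2) inE xM andbT /=.
apply: contraTneq Gd => MU; rewrite -leqNgt -cardsT -MU cardsU.
rewrite mul2n -addnn; apply: leq_trans (leq_subr _ _) _.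
exact: leq_add.
Qed.

End Modules.

(** * Blow-ups containing an embedded copy of [H] *)

Section Blowups.
Variables (H Y : sgraph).

(** The parts are the fibres of [g]; edges inside a fibre are arbitrary. *)
Definition blowup_map (g : Y -> H) : Prop :=
  (forall i, exists y, g y = i) /\
  (forall x y, g x != g y -> edge x y = edge (g x) (g y)).

Definition embedding (f : H -> Y) : Prop :=
  injective f /\ forall x y, edge (f x) (f y) = edge x y.

Lemma prescribed_blowup_map (Up Um : {set H}) :
  prescribed_blowup Up Um Y -> exists g, blowup_map g.
Proof.
case/existsP=> V /and5P[/forallP V0 /forallP Vd /eqP VT /forallP Ve _].
have cov y : exists i, y \in V i.
  have /bigcupP[i _ yi] : y \in \bigcup_i V i by rewrite VT inE.
  by exists i.
pose g y := xchoose (cov y).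
have gV y : y \in V (g y) := xchooseP (cov y).
have edgeE x y i j : i != j -> x \in V i -> y \in V j -> edge x y = edge i j.
  move=> ij xi yj; have /forallP/(_ j) := Ve i; rewrite ij /=.
  case: (edge i j) => /forall_inP/(_ x xi)/forall_inP/(_ y yj) //.
  by move/negbTE.
exists g; split=> [i | x y gxy]; last by rewrite (edgeE _ _ (g x) (g y)).
case/set0Pn: (V0 i) => y yi; exists y; apply/eqP; apply: contraT => gyi.
have /forallP/(_ i) := Vd (g y); rewrite gyi /= => /pred0P/(_ y) /=.
by rewrite gV yi.
Qed.

Lemma module_preim (f : H -> Y) M :
  embedding f -> module M -> module [set x | f x \in M].
Proof.
case=> _ fE /moduleP mM; apply/moduleP => x y z.
by rewrite !inE -!(fE z) => xM yM zM; apply: mM.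
Qed.

(** The preimage under [g] of a proper module of [H] is dominated by one vertex of [Y], so the
    degree bound keeps it from containing the whole copy [f]. *)
Lemma inseparable_blowup f g a b :
  connected_graph H -> (forall y : Y, degree y < #|H|)%N ->
  embedding f -> blowup_map g -> inseparable (g a) (g b) ->
  exists M, [/\ module M, a \in M, b \in M & exists s, f s \notin M].
Proof.
move=> conn degY [f_inj fE] [g_surj gE].
case/existsP=> M /and4P[mM MT aM bM].
exists [set y | g y \in M]; rewrite !inE; split=> //.
  apply/moduleP => x y z; rewrite !inE => xM yM zM.
  have neq t : g t \in M -> g z != g t by apply: contraTneq => <-.
  by rewrite !gE ?neq //; move/moduleP: mM; apply.
have [z zM zdom] := module_dominated conn mM MT aM.
have [y gy] := g_surj z.
apply/existsP; rewrite -negb_forall; apply: contraL (degY y) => /forallP fM.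
rewrite -leqNgt -cardsT -(card_imset _ f_inj); apply/subset_leq_card/subsetP.
move=> _ /imsetP[s _ ->]; have := fM s; rewrite !inE => gM.
by rewrite gE gy ?zdom //; apply: contraTneq gM => <-.
Qed.

Definition separated (T : {set H}) : bool :=
  [forall a in T, forall b in T, inseparable a b ==> (a == b)].

(* A largest separated set [T] of [H] stays one under [g \o f], so adding [g w] spoils it. *)
Lemma blowup_extension f g w :
  connected_graph H -> (1 < #|H|)%N -> (forall y : Y, degree y < #|H|)%N ->
  embedding f -> blowup_map g ->
  exists s M, [/\ module M, w \in M, f s \in M & exists a, f a \notin M].
Proof.
move=> conn H1 degY ef bg.
have sep0 : separated set0 by apply/forall_inP => a; rewrite inE.
case: (arg_maxnP (fun T : {set H} => #|T|) sep0) => T sepT maxT.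
have sepP a b : a \in T -> b \in T -> inseparable a b -> a = b.
  move=> aT bT ab; apply/eqP; move/forall_inP/(_ a aT): sepT.
  by move/forall_inP/(_ b bT); rewrite ab.
have [wT | w_far] := boolP [exists a in T, inseparable (g w) (g (f a))].
  case/exists_inP: wT => a aT wa; exists a.
  by have [M ?] := inseparable_blowup conn degY ef bg wa; exists M.
have far a : a \in T -> ~~ inseparable (g w) (g (f a)).
  by move=> aT; apply: contra w_far => wa; apply/exists_inP; exists a.
(* A module of [Y] missing part of the copy pulls back along [f] to a proper module of [H]. *)
have gf_sep a b : a \in T -> b \in T -> inseparable (g (f a)) (g (f b)) -> a = b.
  move=> aT bT /(inseparable_blowup conn degY ef bg)[M [mM aM bM [s sM]]].
  apply: sepP => //; apply/existsP; exists [set x | f x \in M].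
  rewrite module_preim // !inE aM bM !andbT /=.
  by apply: contra sM => /eqP/setP/(_ s); rewrite !inE => ->.
pose T' := g w |: [set g (f a) | a in T].
have sepT' : separated T'.
  apply/forall_inP => a /setU1P[-> | /imsetP[a' aT ->]];
    apply/forall_inP => b /setU1P[-> | /imsetP[b' bT ->]]; apply/implyP => ab //.
  - by rewrite (negPf (far _ bT)) in ab.
  - by rewrite inseparable_sym (negPf (far _ aT)) in ab.
  - by rewrite (gf_sep a' b').
have := maxT _ sepT'; rewrite /T' cardsU1 card_in_imset => [|a b aT bT gab].
  case: imsetP => [[a aT gwa] | _]; last by rewrite /= add1n ltnn.
  by have := far a aT; rewrite -gwa inseparablexx.
by apply: gf_sep => //; rewrite gab inseparablexx.
Qed.

(** Here [wu] and [wv] are the second copy of the edge [u v]: they see the first copy [f] as [u] and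
    [v] do, except for that edge itself. *)
Lemma no_blowup_with_swap f g u v wu wv :
  connected_graph H -> (2 < #|H|)%N -> (forall y : Y, degree y < #|H|)%N ->
  embedding f -> blowup_map g -> edge u v -> ~~ inseparable u v ->
  (forall x, edge wu (f x) = edge u x && (x != v)) ->
  (forall x, edge wv (f x) = edge v x && (x != u)) ->
  edge wu wv -> False.
Proof.
move=> conn H2 degY ef bg uv sep wuE wvE wuv; have H1 := ltnW H2.
have [s [M1 [m1 w1 s1 [a1 a1M]]]] := blowup_extension wu conn H1 degY ef bg.
have [t [M2 [m2 w2 t2 [a2 a2M]]]] := blowup_extension wv conn H1 degY ef bg.
have fE := ef.2; have vu : edge v u by rewrite edge_sym.
have not_both M a : module M -> f a \notin M -> f u \in M -> f v \in M -> False.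
  move=> mM aM uM vM; case/negP: sep; apply/existsP; exists [set x | f x \in M].
  rewrite module_preim // !inE uM vM !andbT /=.
  by apply: contra aM => /eqP/setP/(_ a); rewrite !inE => ->.
have e_wuu : edge (f u) wu = false by rewrite edge_sym wuE edge_irrefl.
have e_wuv : edge (f v) wu = false by rewrite edge_sym wuE eqxx andbF.
have e_wvu : edge (f u) wv = false by rewrite edge_sym wvE eqxx andbF.
have e_wvv : edge (f v) wv = false by rewrite edge_sym wvE edge_irrefl.
(* If exactly one of [f u], [f v] lay in [M], the other would be adjacent to it but not to [w]. *)
have out w M a : module M -> f a \notin M -> w \in M ->
    edge (f u) w = false -> edge (f v) w = false ->
    f u \notin M /\ f v \notin M.
  move=> mM aM wM uw vw; have [uM | uM] := boolP (f u \in M).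
    case: (not_both M a) => //; apply: contraT => vM.
    by have := moduleP _ mM (f u) w (f v) uM wM vM; rewrite fE vu vw.
  split=> //; apply/negP => vM.
  by have := moduleP _ mM (f v) w (f u) vM wM uM; rewrite fE uv uw.
have [u1 v1] := out _ _ _ m1 a1M w1 e_wuu e_wuv.
have [u2 v2] := out _ _ _ m2 a2M w2 e_wvu e_wvv.
(* If the modules meet, their union is a module. A vertex [f z] outside it sees [wu] and [wv] alike;
   one inside it is missed by [f u] and [f v], as [wu] and [wv] are. So [u] and [v] are twins. *)
have [/existsP[c /andP[c1 c2]] | disj] := boolP [exists c, (c \in M1) && (c \in M2)].
  have mM := moduleP _ (moduleU m1 m2 c1 c2).
  case/negP: sep; apply/existsP; exists [set u; v]; rewrite !inE !eqxx orbT !andbT.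
  apply/andP; split; last first.
    apply: contraTneq H2 => uvT; rewrite -cardsT -uvT cards2.
    by case: (_ != _).
  have uv_same z : z != u -> z != v -> edge u z = edge v z.
    move=> zu zv; have := wuE z; have := wvE z; rewrite zu zv !andbT => <- <-.
    have [zM | zM] := boolP (f z \in M1 :|: M2); last first.
      by rewrite ![edge _ (f z)]edge_sym; apply: mM; rewrite // !inE ?w1 ?w2 ?orbT.
    have -> : edge wu (f z) = false.
      rewrite wuE zv andbT -fE -e_wuu; apply: mM => //; rewrite !inE ?w1 //.
      by rewrite negb_or u1.
    rewrite wvE zu andbT -fE -e_wvv; apply/esym/mM => //; rewrite !inE ?w2 ?orbT //.
    by rewrite negb_or v1.
  apply/moduleP => x y z; rewrite !inE negb_or => xuv yuv /andP[zu zv].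
  have H' c' : (c' == u) || (c' == v) -> edge z c' = edge u z.
    by case/orP=> /eqP->; rewrite edge_sym // uv_same.
  by rewrite !H'.
have tM1 : f t \notin M1.
  by apply: contra disj => tM1; apply/existsP; exists (f t); rewrite tM1.
have wuM2 : wu \notin M2.
  by apply: contra disj => tM2; apply/existsP; exists wu; rewrite w1.
(* As [wu] sees [wv], it sees all of [M2], in particular [f t], so [u] is adjacent to [t]. But [f u]
   misses [wv], hence also [f t]. *)
have : edge wu (f t) by rewrite (moduleP _ m2 (f t) wv wu t2 w2 wuM2).
rewrite wuE => /andP[ut _].
by have := moduleP _ m2 (f t) wv (f u) t2 w2 u2; rewrite fE ut e_wvu.
Qed.

End Blowups.

(** * Doubling a vertex set, and sections of the doubling *)

Section Doubling.
Variables (H : sgraph) (W : {set H}).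

(* The vertices of [W] have two copies, the others only the copy [(x, false)]. *)
Definition doubled_vertex : finType := {p : H * bool | p.2 ==> (p.1 \in W)}.

(** Tags are compared on every edge inside [W]; when [W] is a union of apart pairs, such an edge
    lies within a single pair. *)
Definition doubled_edge : rel doubled_vertex := fun p q =>
  edge (val p).1 (val q).1 &&
  (((val p).1 \in W) && ((val q).1 \in W) ==> ((val p).2 == (val q).2)).

Lemma doubled_edge_sym : symmetric doubled_edge.
Proof.
by move=> p q; rewrite /doubled_edge edge_sym [_ && (_ \in W)]andbC [_.2 == _]eq_sym.
Qed.

Lemma doubled_edge_irrefl : irreflexive doubled_edge.
Proof. by move=> p; rewrite /doubled_edge edge_irrefl. Qed.

Definition doubled : sgraph := SGraph doubled_edge_sym doubled_edge_irrefl.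

Lemma doubled_degree (p : doubled) : (degree p <= 2 * degree (val p).1)%N.
Proof.
rewrite /degree -(card_imset _ val_inj) mulnC -card_bool -cardsT -cardsX.
apply/subset_leq_card/subsetP => _ /imsetP[q + ->].
by rewrite !inE /= /doubled_edge => /andP[-> _].
Qed.

Lemma card_doubled_le : (#|doubled| <= 2 * #|H|)%N.
Proof.
by rewrite card_sig mulnC -card_bool -card_prod; apply: max_card.
Qed.

Lemma section_ofP (A : {set H}) x :
  (x, (x \in A) && (x \in W)).2 ==> ((x, (x \in A) && (x \in W)).1 \in W).
Proof. by apply/implyP => /andP[]. Qed.

Definition section_of (A : {set H}) (x : H) : doubled :=
  exist _ (x, (x \in A) && (x \in W)) (section_ofP A x).

Lemma section_of_inj A : injective (section_of A).
Proof. by move=> x y /(congr1 val) []. Qed.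

Lemma card_doubled_ge : (#|H| <= #|doubled|)%N.
Proof. exact: leq_card (@section_of_inj set0). Qed.

Lemma edge_section_of A B x y :
  edge (section_of A x) (section_of B y) =
  edge x y && ((x \in W) && (y \in W) ==> ((x \in A) == (y \in B))).
Proof.
by rewrite /= /doubled_edge /=; case: (x \in W); case: (y \in W);
  rewrite ?andbF ?andbT.
Qed.

End Doubling.

(** * Edges chosen far apart *)

Section Pairs.
Variables (H : sgraph) (nu : H -> H).
Implicit Types (A B U : {set H}).

Definition pair_at (a : H) : {set H} := [set a; nu a].

Definition pairs A : {set H} := \bigcup_(a in A) pair_at a.

Definition touching (a b : H) : bool :=
  [exists x in pair_at a, exists y in pair_at b, (x == y) || edge x y].

Definition apart U : bool :=
  [forall a in U, forall b in U, touching a b ==> (a == b)].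

Lemma touching_sym : symmetric touching.
Proof.
suff imp a b : touching a b -> touching b a by move=> a b; apply/idP/idP; apply: imp.
case/exists_inP=> x xa /exists_inP[y yb xy]; apply/exists_inP; exists y => //.
by apply/exists_inP; exists x; rewrite // eq_sym edge_sym.
Qed.

Lemma touchingxx a : touching a a.
Proof.
apply/exists_inP; exists a; first by rewrite !inE eqxx.
by apply/exists_inP; exists a; rewrite ?inE eqxx.
Qed.

Lemma apart_eq U a b x y :
  apart U -> a \in U -> b \in U -> x \in pair_at a -> y \in pair_at b ->
  (x == y) || edge x y -> a = b.
Proof.
move=> /forall_inP apU aU bU xa yb xy; apply/eqP.
move/forall_inP/(_ b bU)/implyP: (apU a aU); apply.
by apply/exists_inP; exists x => //; apply/exists_inP; exists y.
Qed.

Lemma mem_pairs U A a x :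
  apart U -> A \subset U -> a \in U -> x \in pair_at a ->
  (x \in pairs A) = (a \in A).
Proof.
move=> apU /subsetP AU aU xa; apply/bigcupP/idP => [[b bA xb] | aA].
  by rewrite (apart_eq apU aU (AU _ bA) xa xb) // eqxx.
by exists a.
Qed.

(** Tags matter only for edges inside [pairs U]; such an edge lies in one pair, whose two ends get
    the same tag. *)
Lemma embedding_section U A :
  apart U -> A \subset U ->
  embedding (section_of (pairs U) (pairs A)).
Proof.
move=> apU AU; split=> [|x y]; first exact: section_of_inj.
rewrite edge_section_of; case xy: (edge x y) => //=.
apply/implyP => /andP[/bigcupP[a aU xa] /bigcupP[b bU yb]].
have eab : a = b by apply: (apart_eq apU aU bU xa yb); rewrite xy orbT.
by rewrite (mem_pairs apU AU aU xa) (mem_pairs apU AU bU yb) eab.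
Qed.

(** At [a] the tags of the two sections disagree, which cuts edges within the pair. A neighbour of
    [e] outside the pair is not in [pairs U] by apartness, so its edge survives. *)
Lemma edge_swapped_section U A B a e x :
  apart U -> A \subset U -> B \subset U -> a \in U ->
  (a \in B) != (a \in A) -> e \in pair_at a ->
  edge (section_of (pairs U) (pairs B) e) (section_of (pairs U) (pairs A) x) =
  edge e x && (x \notin pair_at a).
Proof.
move=> apU AU BU aU aBA ea; rewrite edge_section_of.
case ex: (edge e x) => //=.
have memU z : z \in pair_at a -> z \in pairs U.
  by move=> za; rewrite (mem_pairs apU (subxx U) aU za).
rewrite memU //= (mem_pairs apU BU aU ea).
have [xa | xa] /= := boolP (x \in pair_at a).
  by rewrite memU // (mem_pairs apU AU aU xa) /=; apply/negbTE.
apply/implyP => /bigcupP[b bU xb]; case/negP: xa.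
by rewrite (apart_eq apU aU bU ea xb) // ex orbT.
Qed.

Lemma card_bigcup_le (T : finType) (F : H -> {set T}) A k :
  (forall x, #|F x| <= k)%N -> (#|\bigcup_(x in A) F x| <= #|A| * k)%N.
Proof.
move=> Fk; rewrite -sum_nat_const.
elim/big_rec2: _ => [|x n S xA Sn]; first by rewrite cards0.
rewrite cardsU; apply: leq_trans (leq_subr _ _) _.
exact: leq_add (Fk x) Sn.
Qed.

(** By maximality the pair of each vertex touches a pair of [U], so the balls of radius two around
    the at most [2 * #|U|] vertices of these pairs cover [H]. *)
Lemma apart_maximal_card d :
  (forall x, edge x (nu x)) -> (forall x : H, degree x <= d)%N ->
  exists2 U, apart U & (#|H| <= #|U| * (2 * (d.+1 * d.+1)))%N.
Proof.
move=> edge_nu degd.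
have ap0 : apart set0 by apply/forall_inP => a; rewrite inE.
have [U /maxsetP[apU maxU] _] := maxset_exists ap0.
exists U => //; pose ball x : {set H} := x |: [set y | edge x y].
have card_ball x : (#|ball x| <= d.+1)%N.
  by rewrite cardsU1 inE edge_irrefl add1n ltnS degd.
have card_pair x : (#|pair_at x| <= 2)%N by rewrite cards2; case: (_ != _).
have cover x : exists2 a, a \in U & touching a x.
  have [xU | xU] := boolP (x \in U); first by exists x; rewrite ?touchingxx.
  apply/exists_inP; apply: contraR xU; rewrite negb_exists_in => /forall_inP far.
  rewrite -[U](maxU (x |: U)) ?subsetUr ?setU11 //.
  apply/forall_inP => a /setU1P[-> | aU]; apply/forall_inP => b /setU1P[-> | bU];
    apply/implyP => // ab.
  - by rewrite touching_sym (negPf (far b bU)) in ab.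
  - by rewrite (negPf (far a aU)) in ab.
  - by move/forall_inP: apU => /(_ a aU)/forall_inP/(_ b bU); rewrite ab.
rewrite !mulnA; set W := pairs U.
pose W2 := \bigcup_(y in \bigcup_(x in W) ball x) ball y.
apply: leq_trans (_ : #|W2| <= _)%N; last first.
  apply: leq_trans (card_bigcup_le _ card_ball) _; rewrite leq_mul2r /=.
  apply: leq_trans (card_bigcup_le _ card_ball) _; rewrite leq_mul2r /=.
  exact: card_bigcup_le.
rewrite -cardsT; apply/subset_leq_card/subsetP => x _.
have [a aU /exists_inP[p pa /exists_inP[q qx pq]]] := cover x.
apply/bigcupP; exists q.
  apply/bigcupP; exists p; first by apply/bigcupP; exists a.
  by rewrite !inE eq_sym.
by move: qx; rewrite !inE eq_sym => /orP[-> // | /eqP->]; rewrite edge_sym edge_nu orbT.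
Qed.

End Pairs.

(** * From sections to distinct maximal blow-ups *)

Lemma embedding_blowup (H G : sgraph) (Up Um : {set H}) (f : H -> G) :
  embedding f -> prescribed_blowup Up Um (induced (f @: setT)).
Proof.
(* All parts are singletons, which are both cliques and independent sets. *)
case=> f_inj fE; apply/existsP; exists [ffun i => [set y | val y == f i]].
have inV i (y : induced (f @: setT)) :
  (y \in [ffun i => [set y : induced (f @: setT) | val y == f i]] i) = (val y == f i).
  by rewrite ffunE inE.
apply/and5P; split; last (apply/andP; split).
- apply/forallP => i; apply/set0Pn.
  by exists (exist _ (f i) (imset_f f (in_setT i))); rewrite inV.
- apply/forallP => i; apply/forallP => j; apply/implyP => ij.
  apply/pred0P => y /=; rewrite !inV.
  by apply/negP => /andP[/eqP-> /eqP/f_inj/eqP]; rewrite (negPf ij).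
- apply/eqP/setP => y; rewrite inE; apply/bigcupP.
  by have /imsetP[i _ yi] := valP y; exists i; rewrite ?inV ?yi.
- apply/forallP => i; apply/forallP => j; apply/implyP => _.
  case: ifP => ij; apply/forall_inP => x; rewrite inV => /eqP xi;
    by apply/forall_inP => y; rewrite inV => /eqP yj; rewrite /= /induced_edge xi yj fE ij.
- apply/forall_inP => i _; apply/forall_inP => x; rewrite inV => /eqP xi.
  apply/forall_inP => y; rewrite inV => /eqP yi.
  by apply/implyP; rewrite -val_eqE /= xi yi eqxx.
- apply/forall_inP => i _; apply/forall_inP => x; rewrite inV => /eqP xi.
  apply/forall_inP => y; rewrite inV => /eqP yi.
  by rewrite /= /induced_edge xi yi edge_irrefl.
Qed.

Lemma degree_induced (G : sgraph) (S : {set G}) (y : induced S) :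
  (degree y <= degree (val y))%N.
Proof.
rewrite /degree -(card_imset _ val_inj); apply/subset_leq_card/subsetP.
by move=> _ /imsetP[z + ->]; rewrite !inE.
Qed.

Section Counting.
Variables (H : sgraph) (nu : H -> H) (d : nat) (U Up Um : {set H}).
Hypotheses (conn : connected_graph H) (degd : forall x : H, (degree x <= d)%N).
Hypotheses (d1 : (1 <= d)%N) (large : (2 * d < #|H|)%N).
Hypotheses (edge_nu : forall x, edge x (nu x)).
Hypotheses (sep_nu : forall x, ~~ inseparable x (nu x)).
Hypothesis apU : apart nu U.

Let G := doubled (pairs nu U).
Let sec (A : {set H}) : H -> G := section_of (pairs nu U) (pairs nu A).

(** If [A] and [B] differ at [a], then [S] holds both copies of the edge at [a]: one in the
    embedding [sec A], the other taken from [sec B]. *)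
Lemma blowup_section_unique (A B : {set H}) (S : {set G}) :
  A \subset U -> B \subset U ->
  sec A @: setT \subset S -> sec B @: setT \subset S ->
  prescribed_blowup Up Um (induced S) -> A = B.
Proof.
move=> AU BU /subsetP AS /subsetP BS blowS; apply/eqP; apply: contraT => neqAB.
have [a aU aBA] : exists2 a, a \in U & (a \in B) != (a \in A).
  apply/exists_inP; apply: contraR neqAB; rewrite negb_exists_in => /forall_inP same.
  apply/eqP/setP => x; have [xU | xU] := boolP (x \in U).
    by have := same x xU; rewrite negbK => /eqP.
  by rewrite (contraNF (subsetP AU x)) ?(contraNF (subsetP BU x)).
have [g bg] := prescribed_blowup_map blowS.
have inA x : sec A x \in S by apply/AS/imset_f.
have inB x : sec B x \in S by apply/BS/imset_f.
pose f x : induced S := exist _ (sec A x) (inA x).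
pose w x : induced S := exist _ (sec B x) (inB x).
have ef : embedding f.
  have [sec_inj secE] := embedding_section apU AU; split=> x y; last exact: secE.
  by move/(congr1 val)/sec_inj.
(* Doubling at most doubles degrees, hence the bound [2 * d < #|H|]. *)
have degY (y : induced S) : (degree y < #|H|)%N.
  apply: leq_ltn_trans large; apply: leq_trans (degree_induced y) _.
  by apply: leq_trans (doubled_degree _) _; rewrite leq_mul2l degd.
have H2 : (2 < #|H|)%N by apply: leq_ltn_trans large; rewrite -{1}[2]muln1 leq_mul2l.
have pa : a \in pair_at nu a by rewrite !inE eqxx.
have pna : nu a \in pair_at nu a by rewrite !inE eqxx orbT.
have [||] // := @no_blowup_with_swap H (induced S) f g a (nu a) (w a) (w (nu a))
  conn H2 degY ef bg (edge_nu a) (sep_nu a).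
- move=> x; rewrite [LHS](edge_swapped_section x apU AU BU aU aBA pa).
  case ax: (edge a x) => //=; rewrite !inE negb_or.
  by rewrite (contraTneq _ ax) // => ->; rewrite edge_irrefl.
- move=> x; rewrite [LHS](edge_swapped_section x apU AU BU aU aBA pna).
  case ax: (edge (nu a) x) => //=; rewrite !inE negb_or andbC.
  by rewrite (contraTneq _ ax) // => ->; rewrite edge_irrefl.
- have [_ secE] := embedding_section apU BU.
  by move: (edge_nu a); rewrite -secE.
Qed.

Lemma card_maximal_blowups : (2 ^ #|U| <= #|maximal_blowups Up Um G|)%N.
Proof.
pose P (S : {set G}) := prescribed_blowup Up Um (induced S).
have ext (A : {set H}) : A \in powerset U ->
    {S : {set G} | maxset P S & sec A @: setT \subset S}.
  rewrite inE => AU; apply: maxset_exists.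
  exact: embedding_blowup (embedding_section apU AU).
(* [insub] supplies the membership proof that [ext] needs; [set0] is a dummy value outside
   [powerset U]. *)
pose top (A : {set H}) : {set G} :=
  if insub A : {? A | A \in powerset U} is Some A' then s2val (ext _ (valP A')) else set0.
have topP A : A \in powerset U -> maxset P (top A) /\ sec A @: setT \subset top A.
  by rewrite /top => AU; rewrite insubT /=; case: (ext _ _).
rewrite -card_powerset -(card_in_imset (f := top)).
  apply/subset_leq_card/subsetP => _ /imsetP[A /topP[/maxsetP[PA maxA] _] ->].
  rewrite inE /maximal_blowup; apply/andP; split=> //.
  apply/forallP => S; apply/implyP => AS; apply/negP => PS.
  by have := AS; rewrite (maxA S PS (proper_sub AS)) properxx.
move=> A B AU BU tAB; have [/maxsetp PA sA] := topP A AU.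
have [_ sB] := topP B BU; rewrite -tAB in sB.
by apply: blowup_section_unique sA sB PA; rewrite -powersetE.
Qed.

End Counting.

(** * Assembling the numerical bounds *)

Theorem theorem12 (R : realType) (d : nat) (hd : (2 <= d)%N)
    (H : sgraph) (N : nat) (hN : #|H| = N)
    (hconn : connected_graph H) (hdeg : max_degree H = d)
    (hlarge : (d ^ (d ^ (d ^ d)) < N)%N)
    (Up Um : {set H}) (hdisj : [disjoint Up & Um]) :
  exists G : sgraph,
    [/\ (N <= #|G| <= 2 ^ (d ^ (21 * d + 20)) * N)%N,
        (max_degree G <= d * 2 ^ (d ^ (21 * d + 20)))%N
      & (2 `^ (#|G|%:R / 2 ^+ (d ^ (21 * d + 20))%N)
           <= #|maximal_blowups Up Um G|%:R :> R)%R].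
Proof.
have d1 : (1 <= d)%N by apply: ltnW.
have degd (x : H) : (degree x <= d)%N by rewrite -hdeg; apply: leq_bigmax.
have large : (2 * d < #|H|)%N.
  rewrite hN; apply: leq_ltn_trans hlarge.
  (* [2 * d <= d ^ 2 <= d ^ d], and each further exponential with base [d] only increases this. *)
  apply: leq_trans (_ : d ^ 2 <= _)%N; first by rewrite -mulnn leq_mul2r hd orbT.
  apply: leq_trans (leq_pexp2l d1 hd) _.
  by apply: leq_trans (ltnW (ltn_expl _ hd)) _; apply/ltnW/ltn_expl.
have H1 : (1 < #|H|)%N by apply: leq_ltn_trans large; rewrite muln_gt0.
pose nu x := xchoose (separated_neighbor x hconn H1 degd large).
have nuP x : edge x (nu x) && ~~ inseparable x (nu x).
  exact: xchooseP (separated_neighbor x hconn H1 degd large).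
have edge_nu x : edge x (nu x) by case/andP: (nuP x).
have sep_nu x : ~~ inseparable x (nu x) by case/andP: (nuP x).
have [U apU cardU] := apart_maximal_card edge_nu degd.
exists (doubled (pairs nu U)).
set e := (d ^ (21 * d + 20))%N.
(* The left side bounds the order of the doubled graph divided by [#|U|]. It is at most
   [2 ^ (2 * d.+1)], and [2 * d.+1 <= 21 * d + 20 < e]. *)
have eK : (4 * (d.+1 * d.+1) <= 2 ^ e)%N.
  have -> : (4 * (d.+1 * d.+1) = (2 * d.+1) ^ 2)%N by rewrite expnMn mulnn.
  apply: leq_trans (_ : (2 ^ d.+1) ^ 2 <= _)%N.
    by rewrite leq_exp2r // expnS leq_mul2l /= ltn_expl.
  rewrite -expnM leq_exp2l // /e.
  apply: leq_trans (ltnW (ltn_expl _ hd)).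
  by rewrite mulnC mulnS addnC leq_add // leq_mul2r orbT.
have K2 : (2 <= 2 ^ e)%N.
  by apply: leq_trans eK; rewrite -[2%N]muln1 leq_mul // muln_gt0.
split.
- rewrite -hN card_doubled_ge (leq_trans (card_doubled_le _)) //.
  by rewrite leq_mul2r K2 orbT.
- apply/bigmax_leqP => p _; apply: leq_trans (doubled_degree p) _.
  by rewrite mulnC leq_mul.
- apply: le_trans (_ : (2 `^ #|U|%:R <= _)%R); last first.
    rewrite powR_mulrn // -natrX ler_nat.
    exact: card_maximal_blowups edge_nu sep_nu apU.
  apply: ler_powR; first by rewrite ler1n.
  rewrite ler_pdivrMr ?exprn_gt0 // -natrX -natrM ler_nat.
  apply: leq_trans (card_doubled_le _) _.
  apply: leq_trans (_ : 2 * (#|U| * (2 * (d.+1 * d.+1))) <= _)%N.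
    by rewrite leq_mul2l.
  by rewrite mulnCA [X in (_ * X)%N]mulnA leq_mul2l eK orbT.
Qed.
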